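(* Let $(G,\sigma)$ be a flow-admissible signed graph. If the (unsigned) graph $G$ admits a nowhere-zero $4$-flow, then the signed graph $(G,\sigma)$ admits a nowhere-zero $8$-flow.
   Context: Graphs are finite and may have multiple edges and loops. A signed graph $(G,\sigma)$ is a graph $G$ with a signature $\sigma\colon E(G)\to\{+1,-1\}$; edges with $\sigma(e)=1$ are positive, those with $\sigma(e)=-1$ are negative. A graph without signature is identified with the all-positive signed graph ($\sigma\equiv +1$). Each edge $e=uv$ consists of two half-edges $h_e^u$ and $h_e^v$, where $h_e^u$ is incident with $u$ and $h_e^v$ with $v$ (possibly $u=v$, in which case both half-edges are incident with the same vertex). $H(v)$ denotes the set of all half-edges incident with $v$, $H(G)$ the set of all half-edges, and $e_h$ the edge containing the half-edge $h$. An orientation of $(G,\sigma)$ is a map $\tau\colon H(G)\to\{+1,-1\}$ such that $\tau(h_e^u)\tau(h_e^v)=-\sigma(e)$ for every edge $e=uv$. For an integer $k\ge 2$, a $k$-flow on $(G,\sigma)$ is a pair $(\tau,f)$ consisting of an orientation $\tau$ of $(G,\sigma)$ and a map $f\colon E(G)\to\mathbb{Z}$ such that $\sum_{h\in H(v)}\tau(h)f(e_h)=0$ for every vertex $v$ and $|f(e)|<k$ for every edge $e$. It is nowhere-zero if $f(e)\neq 0$ for every $e\in E(G)$. A signed graph is flow-admissible if it admits a nowhere-zero $k$-flow for some integer $k\ge 2$. A nowhere-zero $k$-flow on the unsigned graph $G$ is a nowhere-zero $k$-flow on the all-positive signed graph with underlying graph $G$. *)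

(* Defs.v *)
From HB Require Import structures.
From mathcomp Require Import all_boot all_order all_algebra.

Set Implicit Arguments.
Unset Strict Implicit.
Unset Printing Implicit Defensive.

Import Order.TTheory GRing.Theory Num.Theory.

Local Open Scope ring_scope.

(* Two edges may have the same end-points (multiple edges), and the two
   end-points of an edge may coincide (a loop). The Boolean only tells apart
   the two half-edges of an edge; it does not orient the edge. *)
Record multigraph := Multigraph {
  vertex : finType;
  edge : finType;
  endpoint : edge -> bool -> vertex
}.

(* The pair (e, b) is the half-edge of e at the vertex endpoint e b; a loop
   still has two half-edges, both incident with the same vertex. *)
Definition half_edge (G : multigraph) : finType := (edge G * bool)%type.

Definition edge_of (G : multigraph) (h : half_edge G) : edge G := h.1.

Definition incident (G : multigraph) (h : half_edge G) (v : vertex G) : bool :=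
  endpoint h.1 h.2 == v.

Definition is_pm1 (x : int) : Prop := x = 1 \/ x = -1.

Definition is_signature (G : multigraph) (sigma : edge G -> int) : Prop :=
  forall e, is_pm1 (sigma e).

Definition all_positive (G : multigraph) : edge G -> int := fun _ => 1.

Arguments all_positive : clear implicits.

Definition is_orientation (G : multigraph) (sigma : edge G -> int)
    (tau : half_edge G -> int) : Prop :=
  (forall h, is_pm1 (tau h)) /\
  (forall e, tau (e, false) * tau (e, true) = - sigma e).

Definition is_flow (G : multigraph) (sigma : edge G -> int) (k : nat)
    (tau : half_edge G -> int) (f : edge G -> int) : Prop :=
  [/\ is_orientation sigma tau,
      forall v : vertex G,
        \sum_(h : half_edge G | incident h v) tau h * f (edge_of h) = 0
    & forall e : edge G, `|f e| < k%:Z].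

Definition nowhere_zero (G : multigraph) (f : edge G -> int) : Prop :=
  forall e, f e <> 0.

Definition has_nowhere_zero_flow (G : multigraph) (sigma : edge G -> int)
    (k : nat) : Prop :=
  exists (tau : half_edge G -> int) (f : edge G -> int),
    is_flow sigma k tau f /\ nowhere_zero f.

Definition flow_admissible (G : multigraph) (sigma : edge G -> int) : Prop :=
  exists k : nat, (2 <= k)%N /\ has_nowhere_zero_flow sigma k.

(* Main.v *)
Require Import Defs.
From mathcomp Require Import all_boot all_order all_algebra.
From mathcomp Require Import zify ring.

(**
A nowhere-zero 4-flow of G covers the edges of G by two even edge sets C1, C2.
Work in one component, with root r. Among C1, C2 and their sum at least one
contains an even number of negative edges; let it be C1. Every even set D with
an even number of negative edges carries a flow with values +1, -1 on D and
absolute value at most 2 elsewhere: traverse an Euler tour of the multigraph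
in which the edges outside D are doubled. With an odd number of negative edges
the tour leaves an excess 2 at r.

If C2 is even too, take f1 + 3 f2. If C1 contains an unbalanced cycle, add it
to C2. Otherwise C1 is balanced; it carries a flow f1 with values +1, -1, and
C2 gives g with excess 2 at r. It suffices to correct g to a flow k with
1 <= |k| <= 3 off C1 and |k| <= 3 on C1, because then 4 f1 + k is the flow
sought. The correction is a walk from r to r of negative sign, which may use
the edges of C1 freely and the other edges only in the direction in which they
already carry g. Within a component of C1 it is routed as half of an Euler
tour on which the signs flip at the entry and at the exit; as the walk passes
there at most twice, this adds at most 1 in absolute value.

If there is no such walk, the reachable vertices, labelled by the sign with
which they are reached, give a linear functional that vanishes on all flows
and is supported either on one edge, which contradicts admissibility, or on
two edges, which then have the same absolute value in every flow, so that one
of them can be contracted.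
*)

Set Implicit Arguments.
Unset Strict Implicit.
Unset Printing Implicit Defensive.

Import Order.TTheory GRing.Theory Num.Theory.

Local Open Scope ring_scope.

(** * Walks and Euler tours *)

Section Walks.
Variable G : multigraph.
Implicit Types (h : half_edge G) (e : edge G) (W : seq (half_edge G)).
Implicit Types (x y z v w : vertex G).

(** A half-edge doubles as a traversal of its edge, starting at its own end; [mate] is the reverse
    traversal. *)
Definition src h := endpoint h.1 h.2.
Definition mate h : half_edge G := (h.1, ~~ h.2).
Definition tgt h := src (mate h).

Lemma mateK : involutive mate.
Proof. by case=> e b; rewrite /mate /= negbK. Qed.

Fixpoint walk x W y :=
  if W is h :: W' then (src h == x) && walk (tgt h) W' y else x == y.

Definition mult W e := count (fun h => h.1 == e) W.

Lemma mult_cat W1 W2 e : mult (W1 ++ W2) e = (mult W1 e + mult W2 e)%N.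
Proof. exact: count_cat. Qed.

Lemma walk_cat x y z W1 W2 :
  walk x W1 y -> walk y W2 z -> walk x (W1 ++ W2) z.
Proof.
elim: W1 x => [|h W1 IH] x /=; first by move/eqP->.
by case/andP=> -> /IH{}IH /IH.
Qed.

Definition visited x W := x :: map tgt W.

Lemma walk_split x W y w : walk x W y -> w \in visited x W ->
  exists W1 W2, [/\ W = W1 ++ W2, walk x W1 w & walk w W2 y].
Proof.
elim: W x => [|h W IH] x /=.
  by move/eqP<-; rewrite /visited /= inE => /eqP->; exists [::], [::]; split=> //=.
case/andP=> hx hW; rewrite /visited /= inE => /orP[/eqP->|hw].
  by exists [::], (h :: W); split; rewrite /= ?hx ?eqxx.
have [W1 [W2 [-> h1 h2]]] := IH _ hW hw.
by exists (h :: W1), W2; split=> //=; rewrite hx.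
Qed.

Lemma walk_last x W y : walk x W y -> y \in visited x W.
Proof.
elim: W x => [|h W IH] x /=; first by move/eqP->; exact: mem_head.
by case/andP=> _ /IH hy; rewrite /visited /= inE hy orbT.
Qed.

Lemma visited_mult x W y h : walk x W y -> (0 < mult W h.1)%N ->
  src h \in visited x W.
Proof.
elim: W x => [|h0 W IH] x //= /andP[/eqP hx hW] hc; move: hc.
rewrite /visited /= inE; case: eqP => [h01 _|_].
  have : (h == h0) || (h == mate h0).
    by apply/orP; move: h01; case: (h) (h0) => e b [e0 b0] /= ->;
      rewrite /mate !xpair_eqE /= eqxx; case: b b0 => [] []; [left|right|right|left].
  case/orP=> /eqP->; first by rewrite hx eqxx.
  by apply/orP; right; rewrite /= mem_head.
by rewrite /= add0n => /(IH _ hW); rewrite /= => ->; rewrite orbT.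
Qed.

Lemma sum_half_edge (R : nmodType) (F : half_edge G -> R) :
  \sum_h F h = \sum_e (F (e, false) + F (e, true)).
Proof.
rewrite (eq_bigr (fun e => \sum_(b : bool) F (e, b))); last first.
  by move=> e _; rewrite big_bool addrC.
by rewrite pair_big /=; apply: eq_bigr => -[].
Qed.

Definition even_at (D : edge G -> bool) v :=
  ~~ \big[addb/false]_(h | incident h v) D h.1.

Lemma xor_step v h0 :
  \big[addb/false]_(h | incident h v) (h.1 == h0.1) = (src h0 == v) (+) (tgt h0 == v).
Proof.
rewrite big_mkcond /= (bigD1 h0) //= (bigD1 (mate h0)) /=; last first.
  by case: h0 => e b; rewrite /mate xpair_eqE eqxx; case: b.
rewrite eqxx /= big1 ?addbF; first by rewrite /incident /tgt /src /=; case: eqP; case: eqP.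
move=> [e b]; case: h0 => [e0 b0] /=; rewrite !xpair_eqE /= => hh; case: ifP => // _.
by apply/negbTE; move: hh; case: eqP => //= _; case: b b0 => [] [].
Qed.

Lemma walk_parity x W y v : walk x W y ->
  \big[addb/false]_(h | incident h v) odd (mult W h.1) = (x == v) (+) (y == v).
Proof.
elim: W x => [|h0 W IH] x /=.
  by move/eqP->; rewrite addbb big1.
case/andP=> /eqP hx /IH{}IH.
under eq_bigr => h _ do rewrite oddD oddb (eq_sym h0.1).
rewrite big_split /= IH xor_step -hx.
by case: (src h0 == v); case: (tgt h0 == v); case: (y == v).
Qed.

Definition adj (m : edge G -> nat) : rel (vertex G) :=
  fun x y => [exists h, [&& (0 < m h.1)%N, src h == x & tgt h == y]].

Section Euler.
Variable m : edge G -> nat.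
Hypothesis m_even : forall v, even_at (fun e => odd (m e)) v.

(** The walk uses an odd number of half-edges at its end [y], while [m] offers an even number
    there. *)
Lemma euler_open x W y : walk x W y -> (forall e, (mult W e <= m e)%N) -> x != y ->
  exists h, (src h == y) && (mult W h.1 < m h.1)%N.
Proof.
move=> hW hm xy; apply/existsP; apply: contraT => /existsPn hn.
have := walk_parity y hW; rewrite (negbTE xy) eqxx /=.
rewrite (eq_bigr (fun h => odd (m h.1))); first by rewrite (negbTE (m_even y)).
move=> h hy; move: (hn h); rewrite (_ : src h == y) //= -leqNgt => hle.
by congr odd; apply/eqP; rewrite eqn_leq hm hle.
Qed.

Lemma euler_maximal r : exists z W, [/\ connect (adj m) r z, walk z W z,
  forall e, (mult W e <= m e)%N &
  forall h, src h \in visited z W -> mult W h.1 = m h.1].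
Proof.
pose N := (\sum_e m e)%N.
suff main n : forall z W y, (N - size W <= n)%N -> connect (adj m) r z ->
    walk z W y -> (forall e, (mult W e <= m e)%N) ->
    exists z W, [/\ connect (adj m) r z, walk z W z,
      forall e, (mult W e <= m e)%N &
      forall h, src h \in visited z W -> mult W h.1 = m h.1].
  by apply: (main N r [::] r); rewrite /= ?leq_subr ?eqxx.
have size_sum W : size W = (\sum_e mult W e)%N.
  elim: W => [|h W IH]; first by rewrite big1.
  rewrite /= IH big_split /= [X in _ = (X + _)%N](bigD1 h.1) //= eqxx.
  rewrite [X in (_ + X + _)%N]big1 ?addn0 ?add1n // => e.
  by rewrite eq_sym => /negbTE->.
have size_lt W h : (forall e, (mult W e <= m e)%N) -> (mult W h.1 < m h.1)%N ->
    (size W < N)%N.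
  move=> hm hlt; rewrite size_sum /N (bigD1 h.1) //= [X in (_ < X)%N](bigD1 h.1) //=.
  by rewrite -addSn leq_add // leq_sum.
have ext W h e : (forall e, (mult W e <= m e)%N) -> (mult W h.1 < m h.1)%N ->
    (mult (rcons W h) e <= m e)%N.
  move=> hm hlt; rewrite -cats1 mult_cat /= addn0.
  by case: eqP => [<-|_]; rewrite ?addn1 ?addn0.
elim: n => [|n IH] z W y hn rz hW hm.
  case: (boolP [exists h, (src h \in visited z W) && (mult W h.1 < m h.1)%N]).
    case/existsP=> h /andP[_ /(size_lt _ _ hm)]; lia.
  move/existsPn=> hno; exists z, W.
  have sat h : src h \in visited z W -> mult W h.1 = m h.1.
    move=> hv; move: (hno h); rewrite hv /= -leqNgt => hle.
    by apply/eqP; rewrite eqn_leq hm hle.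
  case: (eqVneq z y) => [zy|zy]; first by split=> //; rewrite {2}zy.
  have [h /andP[/eqP hy hlt]] := euler_open hW hm zy.
  by move: hlt; rewrite sat ?ltnn // hy (walk_last hW).
case: (eqVneq z y) => [zy|zy]; last first.
  have [h /andP[hy hlt]] := euler_open hW hm zy.
  apply: (IH z (rcons W h) (tgt h)) => //; last by move=> e; apply: ext.
    by move: (size_lt _ _ hm hlt); rewrite size_rcons; lia.
  by rewrite -cats1; apply: walk_cat hW _; rewrite /= hy eqxx.
case: (boolP [exists h, (src h \in visited z W) && (mult W h.1 < m h.1)%N]); last first.
  move/existsPn=> hno; exists z, W; split=> //; first by rewrite {2}zy.
  move=> h hv; move: (hno h); rewrite hv /= -leqNgt => hle.
  by apply/eqP; rewrite eqn_leq hm hle.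
case/existsP=> h /andP[hv hlt].
have [W1 [W2 [EW w1 w2]]] := walk_split hW hv.
have cEW e : mult (W2 ++ W1) e = mult W e by rewrite EW !mult_cat addnC.
have sEW : size (W2 ++ W1) = size W by rewrite EW !size_cat addnC.
have hm' e : (mult (W2 ++ W1) e <= m e)%N by rewrite cEW.
have hlt' : (mult (W2 ++ W1) h.1 < m h.1)%N by rewrite cEW.
apply: (IH (src h) (rcons (W2 ++ W1) h) (tgt h)) => //.
- by move: (size_lt _ _ hm hlt); rewrite size_rcons sEW; lia.
- apply: connect_trans rz _.
  have {}hm W' : (forall e, (mult W' e <= m e)%N) ->
      forall a b, walk a W' b -> connect (adj m) a b.
    elim: W' => [|h' W' IH'] hh a b /=; first by move/eqP->.
    case/andP=> /eqP ha hb; apply: connect_trans (IH' _ _ _ hb); last first.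
      by move=> e; apply: leq_trans (hh e); rewrite /= leq_addl.
    apply: connect1; apply/existsP; exists h'; rewrite ha !eqxx !andbT.
    by apply: leq_trans (hh h'.1); rewrite /= eqxx.
  apply: hm w1 => e; apply: leq_trans (hm' e); by rewrite mult_cat leq_addl.
- rewrite -cats1; apply: walk_cat (_ : walk _ _ (src h)) _; last by rewrite /= !eqxx.
  by apply: walk_cat w2 _; rewrite -zy.
- by move=> e; apply: ext.
Qed.

Lemma adj_sym : connect_sym (adj m).
Proof.
apply: sym_connect_sym => x y; apply/existsP/existsP => -[h /and3P[h1 h2 h3]];
  by exists (mate h); rewrite /tgt mateK h1 h2 andbT.
Qed.

(** The vertices visited by a saturated tour are closed under [adj m], so they include [r], and the
    tour can be rotated to start there. *)
Lemma euler_walk r : exists W, [/\ walk r W r,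
  forall e, (mult W e <= m e)%N &
  forall h, connect (adj m) r (src h) -> mult W h.1 = m h.1].
Proof.
have [z [W [rz hW hm sat]]] := euler_maximal r.
have vis x : connect (adj m) z x -> x \in visited z W.
  move=> /connectP[p hp ->].
  elim/last_ind: p hp => [|p a IH]; first by rewrite mem_head.
  rewrite rcons_path last_rcons => /andP[/IH hl /existsP[h /and3P[h0 /eqP h1 /eqP h2]]].
  have c0 : (0 < mult W (mate h).1)%N by rewrite (sat h) ?h1.
  by rewrite -h2; apply: visited_mult hW c0.
have zr : connect (adj m) z r by rewrite adj_sym.
have [W1 [W2 [EW w1 w2]]] := walk_split hW (vis _ zr).
exists (W2 ++ W1); split.
- exact: walk_cat w2 w1.
- by move=> e; rewrite mult_cat addnC -mult_cat -EW.
- move=> h rh; rewrite mult_cat addnC -mult_cat -EW sat // vis //.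
  exact: connect_trans zr rh.
Qed.
End Euler.
End Walks.

(** * Flows along walks in a signed graph *)

Section Bidirected.
Variable G : multigraph.
Implicit Types (h : half_edge G) (e : edge G) (W : seq (half_edge G)).
Implicit Types (x y z v w : vertex G).

Variable t : half_edge G -> int.
Hypothesis t_pm1 : forall h, is_pm1 (t h).

Definition excess (f : edge G -> int) v : int :=
  \sum_(h | incident h v) t h * f (edge_of h).

(** The signature is read off the orientation: an edge is negative exactly when its two half-edges
    agree. *)
Definition neg e := t (e, false) == t (e, true).

Lemma t_mate h : t (mate h) = - ((-1) ^+ neg h.1 * t h).
Proof.
case: h => e b; rewrite /mate /neg /=.
by case: b; case: (t_pm1 (e, false)) => ->; case: (t_pm1 (e, true)) => ->.
Qed.

Lemma t_sqr h : t h * t h = 1.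
Proof. by case: (t_pm1 h) => ->. Qed.

Lemma eq_excess f g v : f =1 g -> excess f v = excess g v.
Proof. by move=> fg; apply: eq_bigr => h _; rewrite fg. Qed.

Lemma excessD f g v : excess (fun e => f e + g e) v = excess f v + excess g v.
Proof. by rewrite -big_split; apply: eq_bigr => h _; rewrite mulrDr. Qed.

Lemma excessZ a f v : excess (fun e => a * f e) v = a * excess f v.
Proof. by rewrite big_distrr; apply: eq_bigr => h _; rewrite mulrCA. Qed.

(** Summation by parts: a vertex potential [y] becomes a linear functional on edge values that
    vanishes on every flow. *)
Lemma excess_weighted (y : vertex G -> int) f :
  \sum_v y v * excess f v = \sum_e f e * (y (src (e, false)) * t (e, false)
                                    + y (src (e, true)) * t (e, true)).
Proof.
transitivity (\sum_h y (src h) * (t h * f h.1)).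
  rewrite (partition_big (@src G) xpredT) //=; apply: eq_bigr => v _.
  rewrite /excess big_distrr /=; apply: eq_big => h //.
  by rewrite /incident /src => /eqP->.
by rewrite sum_half_edge; apply: eq_bigr => e _ /=; ring.
Qed.

Definition step h0 e : int := if h0.1 == e then t h0 else 0.

Lemma excess_step h0 v :
  excess (step h0) v = (src h0 == v)%:R - (-1) ^+ neg h0.1 * (tgt h0 == v)%:R.
Proof.
rewrite /excess big_mkcond /= (bigD1 h0) //= (bigD1 (mate h0)) /=; last first.
  by case: h0 => e b; rewrite /mate xpair_eqE eqxx; case: b.
rewrite big1 ?addr0.
  rewrite t_mate /step /edge_of /= eqxx mulNr -mulrA t_sqr mulr1.
  rewrite /incident -/(src h0) -/(src (mate h0)) -/(tgt h0).
  by case: eqP; case: eqP => _ _; rewrite ?mulr1 ?mulr0.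
move=> [e b]; case: h0 => [e0 b0] /=; rewrite !xpair_eqE /= => hh.
rewrite /step /=; case: eqP => [ee|]; last by rewrite mulr0 if_same.
by move: hh; rewrite ee eqxx /=; case: b b0 => [] [].
Qed.

Fixpoint walk_neg W := if W is h :: W' then neg h.1 (+) walk_neg W' else false.

(** The sign flips behind each negative edge, which makes consecutive steps cancel at inner
    vertices. *)
Fixpoint walk_flow W e : int :=
  if W is h :: W' then step h e + (-1) ^+ neg h.1 * walk_flow W' e else 0.

Lemma walk_neg_cat W1 W2 : walk_neg (W1 ++ W2) = walk_neg W1 (+) walk_neg W2.
Proof. by elim: W1 => //= h W ->; rewrite addbA. Qed.

Lemma walk_neg_mult W : walk_neg W = \big[addb/false]_e (odd (mult W e) && neg e).
Proof.
elim: W => [|h W IH] /=; first by rewrite big1.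
under eq_bigr => e _ do rewrite oddD oddb andb_addl.
rewrite big_split /= -IH (bigD1 h.1) //= eqxx big1 ?addbF // => e.
by rewrite eq_sym => /negbTE->.
Qed.

Lemma excess_walk_flow x W y v : walk x W y ->
  excess (walk_flow W) v = (x == v)%:R - (-1) ^+ walk_neg W * (y == v)%:R.
Proof.
elim: W x => [|h W IH] x /=.
  by move/eqP->; rewrite mul1r subrr /excess big1 // => h _; rewrite mulr0.
case/andP=> /eqP <- /IH{}IH.
by rewrite excessD excessZ excess_step IH signr_addb; ring.
Qed.

(** Signs vanish modulo 2. With the bound [walk_flow_le] this forces absolute value 1 on an edge
    traversed once. *)
Lemma walk_flow_mult W e : exists k : int, walk_flow W e = (mult W e)%:Z + 2 * k.
Proof.
elim: W => [|h W [k IH]] /=; first by exists 0.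
rewrite IH /step; case: eqP => _; last first.
  by case: (neg h.1); [exists (- k - (mult W e)%:Z) | exists k]; rewrite /=; lia.
case: (t_pm1 h) => ->; case: (neg h.1); [exists (- k - (mult W e)%:Z) | exists k
  | exists (- k - (mult W e)%:Z - 1) | exists (k - 1)]; rewrite /=; lia.
Qed.

Lemma walk_flow_le W e : `|walk_flow W e| <= (mult W e)%:Z.
Proof.
elim: W => [|h W IH] //=.
apply: le_trans (ler_normD _ _) _; rewrite normrM normr_sign mul1r PoszD.
apply: lerD IH; rewrite /step; case: eqP => // _.
by case: (t_pm1 h) => ->.
Qed.

Lemma walk_flow_mult1 W e : mult W e = 1%N -> `|walk_flow W e| = 1.
Proof.
move=> c1; have := walk_flow_le W e; have [k] := walk_flow_mult W e.
by rewrite c1; lia.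
Qed.

Lemma walk_flow_mult0 W e : mult W e = 0%N -> walk_flow W e = 0.
Proof. by move=> c1; have := walk_flow_le W e; rewrite c1; lia. Qed.

Definition parity (D : edge G -> bool) := \big[addb/false]_e (D e && neg e).

Lemma parity_xor D1 D2 :
  parity (fun e => D1 e (+) D2 e) = parity D1 (+) parity D2.
Proof. by rewrite -big_split; apply: eq_bigr => e _; rewrite andb_addl. Qed.

Definition component (r : vertex G) : pred (vertex G) := connect (adj (fun=> 1%N)) r.

Lemma component_endpoint r h : component r (src h) -> component r (tgt h).
Proof.
move=> rh; apply: connect_trans rh (connect1 _).
by apply/existsP; exists h; rewrite !eqxx.
Qed.

Lemma component_edge r e b : component r (endpoint e b) = component r (endpoint e false).
Proof.
by case: b => //; apply/idP/idP; [exact: (@component_endpoint r (e, true))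
                                 |exact: (@component_endpoint r (e, false))].
Qed.

Lemma even_flow r D : (forall v, even_at D v) ->
  (forall e, D e -> component r (endpoint e false)) ->
  exists f, (forall v, excess f v = (1 - (-1) ^+ parity D) * (r == v)%:R) /\
    forall e, component r (endpoint e false) -> if D e then `|f e| = 1 else `|f e| <= 2.
Proof.
move=> Dev DK.
(* Doubling the edges off [D] keeps all degrees even and lets one tour from [r] cover the whole
   component. *)
pose m e := if component r (endpoint e false) then if D e then 1%N else 2%N else 0%N.
have om e : odd (m e) = D e.
  by rewrite /m; case: ifP => [_|hK]; [case: (D e)|apply/esym/negP => /DK; rewrite hK].
have [|W [hW hm sat]] := @euler_walk G m _ r.
  by move=> v; rewrite /even_at; under eq_bigr => h _ do rewrite om; exact: Dev.
have cm e : component r (endpoint e false) -> mult W e = m e.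
  move=> rK; apply: (sat (e, false)); rewrite /src /=.
  case/connectP: rK => p; elim/last_ind: p (endpoint e false) => [|p a IH] x /=.
    by move=> _ ->.
  rewrite rcons_path last_rcons => /andP[hp /existsP[h /and3P[_ /eqP h1 /eqP h2]]] ->.
  apply: connect_trans (IH _ hp erefl) (connect1 _).
  apply/existsP; exists h; rewrite h1 h2 !eqxx /m.
  rewrite -(component_edge _ _ h.2) -/(src h) h1; case: ifP => [_|/negP[]].
    by case: ifP.
  by apply/connectP; exists p.
exists (walk_flow W); split.
  suff -> : parity D = walk_neg W by move=> v; rewrite (excess_walk_flow _ hW) mulrBl mul1r.
  rewrite walk_neg_mult; apply: eq_bigr => e _; congr (_ && _).
  case: (boolP (component r (endpoint e false))) => [/cm->//|hK].
  have := hm e; rewrite -om /m (negbTE hK) leqn0 => /eqP->; by [].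
move=> e rK; have := cm e rK; rewrite /m rK.
by case: (D e) => [/walk_flow_mult1//|c2]; have := walk_flow_le W e; rewrite c2.
Qed.

Definition balanced (D : pred (edge G)) :=
  forall v W, walk v W v -> all (fun h => D h.1) W -> walk_neg W = false.

Lemma walk_in (D : pred (edge G)) W :
  (forall e, (mult W e <= D e)%N) -> all (fun h => D h.1) W.
Proof.
move=> hm; apply/allP => h hW; have := hm h.1; case: (D h.1) => //.
rewrite leqn0 => /eqP c0; have : has (fun h' => h'.1 == h.1) W.
  by apply/hasP; exists h.
by rewrite has_count -/(mult W h.1) c0.
Qed.

Lemma adjP (D : pred (edge G)) x y :
  reflect (exists W, walk x W y /\ all (fun h => D h.1) W)
          (connect (adj (fun e => D e : nat)) x y).
Proof.
apply: (iffP connectP) => [[p hp ->]|[W []]].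
  elim: p x hp => [|a p IH] x /=; first by exists [::]; rewrite /= eqxx.
  case/andP=> /existsP[h /and3P[h0 h1 /eqP h2]] /IH[W [w1 w2]].
  by exists (h :: W); rewrite /= h1 h2 w1 w2 andbT; case: (D h.1) h0.
elim: W x => [|h W IH] x /=; first by move/eqP-> => _; exists [::].
case/andP=> h1 hW /andP[h2 /(IH _ hW)[p hp ->]]; exists (tgt h :: p) => //=.
by rewrite hp andbT; apply/existsP; exists h; rewrite h2 h1 eqxx.
Qed.

(** Each component of [D] gets its own Euler tour from its root; balance leaves no excess there. *)
Lemma balanced_flow D : (forall v, even_at D v) -> balanced D ->
  exists f, (forall v, excess f v = 0) /\ forall e, `|f e| = (D e)%:Z.
Proof.
move=> Dev Dbal.
pose R := adj (fun e => D e : nat).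
have Rsym : connect_sym R by exact: adj_sym.
have Dm v : even_at (fun e => odd (D e : nat)) v.
  by rewrite /even_at; under eq_bigr => h _ do rewrite oddb; exact: Dev.
pose P r W := [&& walk r W r, [forall e, (mult W e <= D e)%N] &
   [forall h, connect R r (src h) ==> (mult W h.1 == D h.1)]].
have /fin_all_exists[W hW] : forall r, exists W, P r W.
  move=> r; have [W [h1 h2 h3]] := euler_walk Dm r.
  exists W; apply/and3P; split=> //; first exact/forallP.
  by apply/forallP => h; apply/implyP => rh; rewrite h3.
pose f e := walk_flow (W (fingraph.root R (endpoint e false))) e.
exists f; split=> [v|e]; last first.
  rewrite /f; set r := fingraph.root _ _.
  have /and3P[_ _ /forallP/(_ (e, false))/implyP/=] := hW r.
  rewrite /src /= Rsym connect_root => /(_ isT) /eqP c.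
  by case: (D e) c => [/walk_flow_mult1|/walk_flow_mult0->].
have /and3P[w1 /forallP w2 _] := hW (fingraph.root R v).
transitivity (excess (walk_flow (W (fingraph.root R v))) v).
  apply: eq_bigr => h; rewrite /incident => /eqP hv; congr (_ * _).
  rewrite /f /edge_of; case: (boolP (D h.1)) => [Dh|/negbTE Dh].
    congr (walk_flow (W _) _); apply/eqP; rewrite (root_connect Rsym) -hv.
    case: h.2 => //; apply: connect1; apply/existsP; exists (h.1, false).
    by rewrite Dh !eqxx.
  have z r : mult (W r) h.1 = 0%N.
    by have /and3P[_ /forallP/(_ h.1)] := hW r; rewrite Dh leqn0 => /eqP.
  by rewrite !walk_flow_mult0.
rewrite (excess_walk_flow _ w1) (Dbal _ _ w1 (walk_in w2)) expr0 mul1r subrr //.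
Qed.

End Bidirected.

(** * One connected component *)

Section Component.
Variable G : multigraph.
Implicit Types (h : half_edge G) (e : edge G) (W : seq (half_edge G)).
Implicit Types (x y z v w : vertex G).

Variable t : half_edge G -> int.
Hypothesis t_pm1 : forall h, is_pm1 (t h).
Local Notation excess := (excess t).
Local Notation neg := (neg t).

Variable r : vertex G.
Local Notation inK e := (component r (endpoint e false)).

Lemma even_even C1 C2 : (forall v, even_at C1 v) -> (forall v, even_at C2 v) ->
  (forall e, C1 e -> inK e) -> (forall e, C2 e -> inK e) ->
  (forall e, inK e -> C1 e || C2 e) -> ~~ parity t C1 -> ~~ parity t C2 ->
  exists f, (forall v, excess f v = 0) /\ forall e, inK e -> f e <> 0 /\ `|f e| < 8.
Proof.
move=> ev1 ev2 K1 K2 cov /negbTE p1 /negbTE p2.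
have [f1 [b1 h1]] := even_flow t_pm1 ev1 K1.
have [f2 [b2 h2]] := even_flow t_pm1 ev2 K2.
(* Nonzero: on [C1], [f1] is not divisible by 3; off [C1], [|f1| <= 2] while [|3 f2| = 3]. No
   absolute value exceeds [1 + 3 * 2]. *)
exists (fun e => f1 e + 3 * f2 e); split=> [v|e eK].
  by rewrite excessD excessZ b1 b2 p1 p2 subrr !mul0r mulr0 addr0.
have := cov e eK; move: (h1 e eK) (h2 e eK).
by case: (C1 e); case: (C2 e) => //= *; split; lia.
Qed.

Lemma abs_parity (x : int) (n : nat) : `|x| = n%:Z -> exists k : int, x = n%:Z + 2 * k.
Proof. by case: (lerP 0 x) => sx nx; [exists 0|exists x]; lia. Qed.

Lemma sum_nat2 (I : finType) (n : I -> nat) : (\sum_i n i = 2)%N ->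
  (exists i, n i = 2%N /\ forall j, j != i -> n j = 0%N) \/
  (exists i j, [/\ i != j, n i = 1%N, n j = 1%N &
     forall k, k != i -> k != j -> n k = 0%N]).
Proof.
move=> s2; have [i ni] : exists i, n i != 0%N.
  apply/existsP; apply: contraT => /existsPn n0; move: s2; rewrite big1 // => i _.
  by have := n0 i; rewrite negbK => /eqP.
move: s2; rewrite (bigD1 i) //=; case: (ltngtP (n i) 1) => [|n1 s2|n1 s2].
- by rewrite ltnS leqn0 (negbTE ni).
- left; exists i; have n2 : n i = 2%N by lia.
  split=> // j ji; have : (\sum_(i0 | i0 != i) n i0 == 0)%N by apply/eqP; lia.
  by rewrite sum_nat_eq0 => /forall_inP/(_ j ji)/eqP.
right; have [j /andP[ji nj]] : exists j, (j != i) && (n j != 0%N).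
  apply/existsP; apply: contraT => /existsPn n0; move: s2; rewrite big1 => [|j ji]; first by lia.
  by have := n0 j; rewrite ji negbK => /eqP.
move: s2; rewrite (bigD1 j) //= => s2.
exists i, j; split=> //; [by rewrite eq_sym|by lia|move=> k ki kj].
have : (\sum_(i0 | (i0 != i) && (i0 != j)) n i0 == 0)%N by apply/eqP; lia.
by rewrite sum_nat_eq0 => /forall_inP/(_ k); rewrite ki kj => /(_ isT)/eqP.
Qed.

(** * Balanced [C1] and odd [C2]: the correcting walk *)

Section OddCase.
Variable C1 : pred (edge G).
Hypothesis ev1 : forall v, even_at C1 v.
Hypothesis bal : balanced t C1.

Variable g : edge G -> int.
Hypothesis bdg : forall v, excess g v = 2 * (r == v)%:R.
Hypothesis gC1 : forall e, C1 e -> `|g e| <= 2.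
Hypothesis gM : forall e, inK e -> ~~ C1 e -> `|g e| = 1.

Let state : finType := (vertex G * bool)%type.

(** The states form the signed double cover; this relation lifts the edges of [C1] to it. *)
Definition free_step : rel state := fun p q =>
  [exists h, [&& C1 h.1, src h == p.1 & q == (tgt h, p.2 (+) neg h.1)]].

Lemma free_step_sym : connect_sym free_step.
Proof.
apply: sym_connect_sym => -[x a] [y b].
apply/existsP/existsP => -[h /and3P[h1 /eqP/= h2 /eqP[h3 h4]]];
  exists (mate h); rewrite /tgt mateK h1 h2 h3 h4 eqxx /=;
  by rewrite addbK.
Qed.

(** A canonical representative of a component of the lifted [C1]. *)
Definition node (p : state) : state := fingraph.root free_step p.

Lemma node_eq p q : (node p == node q) = connect free_step p q.
Proof. exact: (root_connect free_step_sym p q). Qed.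

Lemma node_step h b : C1 h.1 -> node (tgt h, b (+) neg h.1) = node (src h, b).
Proof.
move=> h1; apply/eqP; rewrite node_eq free_step_sym; apply: connect1; apply/existsP.
by exists h; rewrite h1 !eqxx.
Qed.

Lemma walk_node x W y b : walk x W y -> all (fun h => C1 h.1) W ->
  node (x, b) = node (y, b (+) walk_neg t W).
Proof.
elim: W x b => [|h W IH] x b /=; first by move/eqP->; rewrite addbF.
case/andP=> /eqP <- hW /andP[h1 /(IH _ (b (+) neg h.1) hW)].
by rewrite node_step // addbA.
Qed.

Lemma free_walk p q : connect free_step p q ->
  exists W, [/\ walk p.1 W q.1, all (fun h => C1 h.1) W & q.2 = p.2 (+) walk_neg t W].
Proof.
case/connectP=> s; elim: s p => [|a s IH] p /=.
  by move=> _ ->; exists [::]; rewrite /= eqxx addbF.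
case/andP=> /existsP[h /and3P[h1 h2 /eqP ea]] /IH{}IH /IH[W []].
by rewrite ea /= => w1 w2 ->; exists (h :: W); rewrite /= h1 h2 w1 w2 addbA.
Qed.

(** A walk in [C1] joining the two states would be closed and negative. *)
Lemma node_bal x b : node (x, b) != node (x, ~~ b).
Proof.
rewrite node_eq; apply/negP => /free_walk[W [/= w1 w2]].
by rewrite (bal w1 w2) addbF; case: b.
Qed.
Lemma comp_visited (D : pred (edge G)) u x W : walk u W u ->
  (forall h, connect (adj (fun e => D e : nat)) u (src h) -> mult W h.1 = D h.1) ->
  connect (adj (fun e => D e : nat)) u x -> x \in visited u W.
Proof.
move=> hW sat /connectP[p]; elim/last_ind: p x => [|p a _] x /=.
  by move=> _ ->; apply: mem_head.
rewrite rcons_path last_rcons => /andP[hp /existsP[h /and3P[h0 /eqP h1 /eqP <-]]] ->.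
apply: (visited_mult hW); rewrite /= sat // h1; apply/connectP; by exists p.
Qed.

(** For a path without repeated nodes, this counts its visits to the component of [C1] at [x], hence
    at most two. *)
Definition nodes_at (x : vertex G) (U : seq state) : nat :=
  (node (x, true) \in U) + (node (x, false) \in U).

Lemma nodes_at_edge e U : C1 e ->
  nodes_at (endpoint e true) U = nodes_at (endpoint e false) U.
Proof.
move=> e1; rewrite /nodes_at -!(@node_step (e, false)) //=.
by rewrite /tgt /src /=; case: (neg e) => //=; rewrite addnC.
Qed.

(** The vertex of [z'] splits an Euler tour into two walks, of equal sign by balance. Subtracting
    the signed second one from the first doubles the excess at both ends, and each edge of the tour
    keeps absolute value 1. *)
Lemma component_lift (z z' : state) : node z = node z' -> exists a,
  (forall v, excess a v =
     2 * ((-1) ^+ z.2 * (z.1 == v)%:R - (-1) ^+ z'.2 * (z'.1 == v)%:R)) /\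
  forall e, `|a e| = if C1 e then (nodes_at (endpoint e false) [:: node z])%:Z else 0.
Proof.
case: z z' => [u b] [x b'] /= zz'.
have D1m v : even_at (fun e => odd (C1 e : nat)) v.
  by rewrite /even_at; under eq_bigr => h _ do rewrite oddb; exact: ev1.
have [W [hW hm sat]] := euler_walk D1m u.
have WC : all (fun h => C1 h.1) W by exact: walk_in.
have ux : connect (adj (fun e => C1 e : nat)) u x.
  have /free_walk[W' [w1 w2 _]] : connect free_step (u, b) (x, b') by rewrite -node_eq zz'.
  by apply/adjP; exists W'.
have [W1 [W2 [EW w1 w2]]] := walk_split hW (comp_visited hW sat ux).
move: (WC); rewrite EW all_cat => /andP[WC1 WC2].
have q2 : walk_neg t W2 = walk_neg t W1.
  by have := bal hW WC; rewrite EW walk_neg_cat; case: (walk_neg t W1); case: (walk_neg t W2).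
have Eb : b' = b (+) walk_neg t W1.
  have := walk_node b w1 WC1; rewrite zz' => hn; apply/eqP; apply: contraT => hb.
  have := node_bal x b'; rewrite hn => /negP[]; apply/eqP; congr (node (_, _)).
  by move: hb; case: b' {zz' hn}; case: (b (+) _).
exists (fun e => (-1) ^+ b *
  (walk_flow t W1 e - (-1) ^+ walk_neg t W1 * walk_flow t W2 e)); split=> [v|e].
  rewrite (eq_excess t v (g := fun e => (-1) ^+ b * walk_flow t W1 e
      + (- (-1) ^+ b * (-1) ^+ walk_neg t W1) * walk_flow t W2 e)); last by move=> e; ring.
  rewrite excessD !excessZ (excess_walk_flow t_pm1 _ w1) (excess_walk_flow t_pm1 _ w2).
  rewrite q2 Eb signr_addb.
  by case: b {zz' Eb}; case: (walk_neg t W1); rewrite /=; ring.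
have cW : mult W e = (mult W1 e + mult W2 e)%N by rewrite EW mult_cat.
have ce : mult W e = (C1 e && connect (adj (fun e => C1 e : nat)) u (endpoint e false)).
  case: (boolP (connect _ _ _)) => [|hn]; first by move/(sat (e, false)); rewrite andbT.
  rewrite andbF; apply/eqP; rewrite -leqn0 leqNgt; apply/negP => c0.
  have [W3 [W4 [E3 w3 w4]]] := walk_split hW (visited_mult (h := (e, false)) hW c0).
  move/negP: hn; apply; apply/adjP; exists W3; split=> //.
  by move: WC; rewrite E3 all_cat => /andP[].
rewrite normrM normr_sign mul1r.
have -> : `|walk_flow t W1 e - (-1) ^+ walk_neg t W1 * walk_flow t W2 e| = (mult W e)%:Z.
  have := leq_trans (hm e) (leq_b1 _); rewrite cW.
  case c1: (mult W1 e) => [|[|n1]] //; case c2: (mult W2 e) => [|[|n2]] // _.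
  - by rewrite !walk_flow_mult0 // mulr0 subr0.
  - rewrite (walk_flow_mult0 t_pm1 c1) sub0r normrN normrM normr_sign mul1r.
    by rewrite walk_flow_mult1.
  - by rewrite (walk_flow_mult0 t_pm1 c2) mulr0 subr0 walk_flow_mult1.
rewrite ce; case: (boolP (C1 e)) => //= e1; congr Posz.
rewrite /nodes_at !inE.
case: (boolP (connect _ _ _)) => [/adjP[W' [w' w'C]]|hn].
  have hb := walk_node b w' w'C.
  have := node_bal (endpoint e false) (b (+) walk_neg t W').
  rewrite hb; case: (b (+) _) => /= hne; rewrite eqxx.
    by rewrite eq_sym (negbTE hne).
  by rewrite eq_sym (negbTE hne).
have no c : (node (endpoint e false, c) == node (u, b)) = false.
  apply/negP; rewrite eq_sym node_eq => /free_walk[W' [w1' w2' _]].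
  by move/negP: hn; apply; apply/adjP; exists W'.
by rewrite !no.
Qed.

(* A state [(v, b)] is the vertex [v] reached with the sign [(-1) ^+ b];
   [exit_sign h] is the [b] with which leaving through [h] agrees with [g]. *)
Definition exit_sign h : bool := t h * g h.1 == -1.

(** Components of the lifted [C1] are shrunk to points; the other edges may be crossed only so that
    the walk adds to [g]. *)
Definition arc : rel state := fun p q =>
  [exists h, [&& inK h.1, ~~ C1 h.1, node (src h, exit_sign h) == p &
                 node (tgt h, exit_sign h (+) neg h.1) == q]].

(** Bounds the crossings of [e] by a path without repeated nodes, since each direction of [e] leaves
    from a single node. *)
Definition exits e (U : seq state) : nat :=
  (node (src (e, false), exit_sign (e, false)) \in U)
  + (node (src (e, true), exit_sign (e, true)) \in U).

(** Lifts inside components alternate with doubled crossings, and the excesses telescope. The factor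
    2 avoids halves; it is divided out in [reached_flow]. *)
Lemma path_flow p ps (z z' : state) : path arc p ps -> uniq (p :: ps) ->
  node z = p -> node z' = last p ps -> exists c,
  [/\ forall v, excess c v =
        2 * ((-1) ^+ z.2 * (z.1 == v)%:R - (-1) ^+ z'.2 * (z'.1 == v)%:R),
      forall e, C1 e -> `|c e| <= (nodes_at (endpoint e false) (p :: ps))%:Z /\
        exists k : int, c e = (nodes_at (endpoint e false) (p :: ps))%:Z + 2 * k &
      forall e, ~~ C1 e -> exists2 n : nat, (n <= exits e (p :: ps))%N &
        c e = 2 * (n%:Z * g e)].
Proof.
elim: ps p z => [|q ps IH] p z /=.
  move=> _ _ hz hz'; have [|a [ba ha]] := @component_lift z z'; first by rewrite hz hz'.
  exists a; split=> // e e1; have := ha e.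
    rewrite e1 hz => he; split; first by rewrite he.
    exact: abs_parity he.
  rewrite (negbTE e1) => /eqP; rewrite normr_eq0 => /eqP->.
  by exists 0%N; rewrite // mul0r mulr0.
case/andP=> /existsP[h /and4P[hK h1 /eqP hp /eqP hq]] hps /andP[pU qU] hz hz'.
have [|a [ba ha]] := @component_lift z (src h, exit_sign h); first by rewrite hz hp.
have [c [bc cC cM]] := IH q (tgt h, exit_sign h (+) neg h.1) hps qU hq hz'.
exists (fun e => a e + (2 * (-1) ^+ exit_sign h * step t h e + c e)); split.
- move=> v; rewrite excessD excessD excessZ (excess_step t_pm1) ba bc /= signr_addb.
  ring.
- move=> e e1; have [c1 [k ck]] := cC e e1.
  have -> : step t h e = 0 by rewrite /step; case: eqP h1 => // ->; rewrite e1.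
  have nE : nodes_at (endpoint e false) (p :: q :: ps) =
    (nodes_at (endpoint e false) [:: p] + nodes_at (endpoint e false) (q :: ps))%N.
    have no s : ((s \in p :: q :: ps) : nat) = ((s \in [:: p]) + (s \in q :: ps))%N.
      rewrite [in LHS]inE [s \in [:: p]]inE; case: eqP => [->|//].
      by rewrite (negbTE pU).
    by rewrite /nodes_at !no addnACA.
  move: (ha e); rewrite e1 hz nE => ae; rewrite mulr0 add0r PoszD; split.
    by apply: le_trans (ler_normD _ _) _; rewrite ae lerD2l.
  by have [j ->] := abs_parity ae; rewrite ck; exists (j + k); ring.
- move=> e e1; have [n hn ->] := cM e e1.
  have -> : a e = 0.
    by have /eqP := ha e; rewrite (negbTE e1) normr_eq0 => /eqP.
  have mono s : ((s \in q :: ps) <= (s \in p :: q :: ps))%N.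
    by rewrite [in leqRHS]inE; case: (s \in _); rewrite ?orbT.
  rewrite /step; case: eqP => he; last first.
    by exists n; [apply: leq_trans hn _; apply: leq_add|ring].
  (* The crossing leaves from [p], which does not recur in [q :: ps], so [exits] grows by at least
     1. *)
  exists n.+1.
    apply: leq_ltn_trans hn _; move: hp pU; rewrite /exits -he.
    case: h {h1 hq ha ba bc he hK} => e' [] /= hp pU.
      rewrite [leqRHS]addnC [X in (X < _)%N]addnC -addSn leq_add //.
      by rewrite hp (negbTE pU) mem_head.
    by rewrite -addSn leq_add // hp (negbTE pU) mem_head.
  rewrite /exit_sign he -(addn1 n) PoszD.
  have [->|->] : g e = 1 \/ g e = -1 by move: (gM (e := e)); rewrite -he => /(_ hK h1); lia.
    by case: (t_pm1 h) => -> /=; ring.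
  by case: (t_pm1 h) => -> /=; ring.
Qed.

Lemma reached_flow : connect arc (node (r, true)) (node (r, false)) ->
  exists f, (forall v, excess f v = 0) /\ forall e, inK e -> f e <> 0 /\ `|f e| < 8.
Proof.
case/connectP=> ps0 hp0; case/shortenP: hp0 => ps hps Ups _ hlast.
have [c [bc cC cM]] := path_flow hps Ups erefl hlast.
set U := node (r, true) :: ps in bc cC cM.
have [f1 [bf1 f1C]] := balanced_flow t_pm1 ev1 bal.
have f10 e : ~~ C1 e -> f1 e = 0.
  by move=> e1; have /eqP := f1C e; rewrite (negbTE e1) normr_eq0 => /eqP.
(* Pads [c] by a flow on the components of [C1] that the path visits once, so
   that all values become even. *)
pose q e := if odd (nodes_at (endpoint e false) U) then f1 e else 0.
have bq v : excess q v = 0.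
  (* [nodes_at] agrees at both ends of an edge of [C1], so around [v] the map [q] is either [f1] or
     0. *)
  transitivity (excess (fun e => (if odd (nodes_at v U) then 1 else 0) * f1 e) v); last first.
    by rewrite excessZ bf1 mulr0.
  apply: eq_bigr => -[e b]; rewrite /incident /edge_of /= => /eqP hv; congr (_ * _).
  rewrite /q; case: (boolP (C1 e)) => [e1|/f10->]; last by rewrite mulr0 if_same.
  have -> : nodes_at v U = nodes_at (endpoint e false) U.
    by rewrite -hv; case: b {hv} => //; apply: nodes_at_edge.
  by case: ifP => _; rewrite ?mul1r ?mul0r.
have nodes2 x : (nodes_at x U <= 2)%N.
  by rewrite /nodes_at; case: (_ \in U); case: (_ \in U).
have exits2 e : (exits e U <= 2)%N.
  by rewrite /exits; case: (_ \in U); case: (_ \in U).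
have /fin_all_exists[k kP] : forall e, exists k : int, c e + q e = 2 * k /\
    (C1 e -> `|k| <= 1) /\ (~~ C1 e -> exists2 n : nat, (n <= 2)%N & k = n%:Z * g e).
  move=> e; case: (boolP (C1 e)) => e1.
    have [c1 [k ck]] := cC e e1; move: (nodes2 (endpoint e false)) c1 ck (f1C e).
    rewrite /q e1; move: (nodes_at _ _) => n.
    case: n => [|[|[|//]]] _ /=.
    - by move=> c0 _ _; exists 0; split; [lia|split].
    - move=> c1 ck f1e; exists (k + (if f1 e == 1 then 1 else 0)).
      by split; [case: eqP; lia|split=> //; case: eqP; lia].
    - by move=> c2 ck _; exists (1 + k); split; [lia|split=> //; lia].
  have [n hn ->] := cM e e1; exists (n%:Z * g e).
  rewrite /q f10 // if_same addr0; split=> //; split=> // _; exists n => //.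
  exact: leq_trans hn (exits2 e).
(* The path reverses the sign at [r], so [c] has excess -4 there; half of it cancels the excess 2 of
   [g]. *)
have bk v : excess k v = - 2 * (r == v)%:R.
  apply: (@mulfI _ 2) => //; rewrite -excessZ.
  rewrite -(eq_excess t v (fun e => proj1 (kP e))) excessD bq bc /=.
  by rewrite expr1 expr0; ring.
(* On [C1], [|4 f1| = 4] and [|g + k| <= 3]; off [C1], the value is [(n + 1) g] with [n <= 2]. *)
exists (fun e => 4 * f1 e + (g e + k e)); split=> [v|e eK].
  by rewrite excessD excessZ excessD bf1 bdg bk; ring.
have [_ [kC kM]] := kP e; case: (boolP (C1 e)) => e1.
  by have := f1C e; have := gC1 e1; have := kC e1; rewrite e1; lia.
have [n n2 ->] := kM e1; rewrite (f10 e e1).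
have [->|->] : g e = 1 \/ g e = -1 by move: (gM eK e1); lia.
  by lia.
by lia.
Qed.

(** * The cut obtained when no correcting walk exists *)

Definition flip (p : state) : state := (p.1, ~~ p.2).

Lemma node_flip p : node (flip (node p)) = node (flip p).
Proof.
apply/eqP; rewrite node_eq free_step_sym.
have /free_walk[W [w1 w2 w3]] : connect free_step p (node p) by exact: connect_root.
rewrite -node_eq /flip (walk_node _ w1 w2) w3 /=.
by case: (p.2); case: (walk_neg t W).
Qed.

(** Crossing an edge in reverse with the opposite sign adds the same value to it, so paths can be
    run backwards with all signs negated. *)
Lemma arc_flip p q : connect arc p q ->
  connect arc (node (flip q)) (node (flip p)).
Proof.
case/connectP=> s; elim: s p => [|a s IH] p /=; first by move=> _ ->.
case/andP=> /existsP[h /and4P[hK h1 /eqP<- /eqP ea]] /IH{}IH /IH{}IH.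
apply: connect_trans IH (connect1 _); apply/existsP; exists (mate h).
rewrite h1 hK -ea !node_flip /tgt mateK /flip /=.
have -> : exit_sign (mate h) = ~~ (exit_sign h (+) neg h.1).
  rewrite /exit_sign (t_mate t_pm1) /=.
  have [->|->] : g h.1 = 1 \/ g h.1 = -1 by move: (gM hK h1); lia.
    by case: (t_pm1 h) => ->; case: (neg h.1).
  by case: (t_pm1 h) => ->; case: (neg h.1).
by rewrite -addNb -addbA addbb addbF !eqxx.
Qed.

Definition reached x b := connect arc (node (r, true)) (node (x, b)).

(** The potential of the cut: the sign with which [x] is reached, unique by [reached_once], or 0. *)
Definition label x : int :=
  if component r x then (reached x false)%:Z - (reached x true)%:Z else 0.

Hypothesis unreached : ~~ reached r false.

(** Otherwise the path to [(x, true)] could be continued by the flip of the path to [(x, false)],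
    which ends at [(r, false)]. *)
Lemma reached_once x : ~~ (reached x true && reached x false).
Proof.
apply/negP => /andP[h1 /arc_flip]; rewrite node_flip => h2.
have h3 : connect arc (node (x, true)) (node (r, false)) by rewrite node_flip in h2.
by move/negP: unreached; apply; apply: connect_trans h1 h3.
Qed.

Lemma label_C1 h : C1 h.1 -> label (src h) * t h + label (tgt h) * t (mate h) = 0.
Proof.
move=> h1; rewrite (t_mate t_pm1) /label.
have -> : component r (tgt h) = component r (src h).
  by rewrite /tgt /src !component_edge.
case: ifP => _; last by rewrite !mul0r addr0.
rewrite /reached -!(@node_step h _ h1).
by case: (neg h.1) => /=; ring.
Qed.

Lemma reached_label x (b : bool) : component r x -> reached x b -> label x = (-1) ^+ b.
Proof.
move=> rx; rewrite /label rx; have := reached_once x.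
by case: b; case: (reached x true); case: (reached x false).
Qed.

Lemma label_reached x (b : bool) : label x = (-1) ^+ b -> reached x b.
Proof.
rewrite /label; case: ifP => _; last by case: b.
by case: b; case: (reached x true); case: (reached x false).
Qed.

(** The value 1 means that [src h] is reached with the sign that permits leaving along [h]; then
    [tgt h] is reached too and its term cancels. *)
Lemma label_M h : inK h.1 -> ~~ C1 h.1 -> label (src h) * t h * g h.1 = 1 ->
  label (tgt h) * t (mate h) * g h.1 = -1.
Proof.
move=> hK h1 hl.
have tg : t h * g h.1 = (-1) ^+ exit_sign h.
  rewrite /exit_sign.
  have [->|->] : g h.1 = 1 \/ g h.1 = -1 by move: (gM hK h1); lia.
    by case: (t_pm1 h) => ->.
  by case: (t_pm1 h) => ->.
have /label_reached rs : label (src h) = (-1) ^+ exit_sign h.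
  move: hl; rewrite -mulrA tg; case: (exit_sign h) => /=; rewrite ?expr1 ?expr0; lia.
have rt : reached (tgt h) (exit_sign h (+) neg h.1).
  apply: connect_trans rs (connect1 _); apply/existsP; exists h.
  by rewrite hK h1 !eqxx.
rewrite (reached_label _ rt); last by rewrite /tgt /src component_edge.
rewrite (t_mate t_pm1) signr_addb mulrN mulNr -mulrA -[_ * t h * _]mulrA tg.
by case: (exit_sign h); case: (neg h.1).
Qed.

Lemma unreached_cut :
  (exists e, forall f, (forall v, excess f v = 0) -> f e = 0) \/
  (exists e1 e2, [/\ e1 != e2, endpoint e1 false != endpoint e1 true &
    forall f, (forall v, excess f v = 0) -> `|f e1| = `|f e2| ]).
Proof.
pose kap e := label (src (e, false)) * t (e, false) + label (src (e, true)) * t (e, true).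
have label_le x : `|label x| <= 1.
  rewrite /label; case: ifP => // _; by case: (reached x true); case: (reached x false).
have kap0 e : ~~ (inK e && ~~ C1 e) -> kap e = 0.
  rewrite negb_and negbK => /orP[eK|e1]; last exact: (@label_C1 (e, false)).
  by rewrite /kap /label /src /= component_edge (negbTE eK) !mul0r.
(* By [label_M] a term 1 at one end is matched by -1 at the other, so [g e * kap e] is never
   positive. *)
have gkap e : g e * kap e = - `|kap e|.
  case: (boolP (inK e && ~~ C1 e)) => [/andP[eK e1]|/kap0->]; last by rewrite mulr0.
  have m1 := @label_M (e, false) eK e1; have m2 := @label_M (e, true) eK e1.
  move: (label_le (src (e, false))) (label_le (src (e, true))) m1 m2.
  rewrite /kap /tgt /mate /=; move: (label _) (label _) => x y hx hy.
  have [->|->] : g e = 1 \/ g e = -1 by move: (gM eK e1); lia.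
    by case: (t_pm1 (e, false)) => ->; case: (t_pm1 (e, true)) => ->; lia.
  by case: (t_pm1 (e, false)) => ->; case: (t_pm1 (e, true)) => ->; lia.
have flow0 f : (forall v, excess f v = 0) -> \sum_e f e * kap e = 0.
  by move=> bf; rewrite -excess_weighted big1 // => v _; rewrite bf mulr0.
have lr : label r = -1 by apply: (@reached_label r true); exact: connect0.
(* Pairing [label] with the excess of [g] gives -2, and no summand is positive. *)
have sum2 : (\sum_e `|kap e|%N = 2)%N.
  have : \sum_e g e * kap e = -2.
    rewrite -excess_weighted (bigD1 r) //= bdg eqxx lr big1 ?addr0 // => v vr.
    by rewrite bdg eq_sym (negbTE vr) !mulr0.
  rewrite (eq_bigr (fun e => - `|kap e|%N%:Z)) => [|e _]; last by rewrite gkap abszE.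
  by rewrite sumrN -(big_morph Posz PoszD (erefl _)); lia.
have [[e [e2 z]]|[e1 [e2 [e12 n1 n2 z]]]] := sum_nat2 sum2; [left|right].
  exists e => f /flow0; rewrite (bigD1 e) //= big1 ?addr0.
    by move=> /eqP; rewrite mulf_eq0 => /orP[/eqP//|/eqP k0]; rewrite k0 in e2.
  by move=> j /z/eqP; rewrite absz_eq0 => /eqP->; rewrite mulr0.
exists e1, e2; split=> //.
  (* On a loop [kap] is even, hence not of absolute value 1. *)
  apply/eqP => loop; move: n1; rewrite /kap /src /= -loop -mulrDr.
  move: (label _) => x.
  by case: (t_pm1 (e1, false)) => ->; case: (t_pm1 (e1, true)) => ->; lia.
move=> f /flow0; rewrite (bigD1 e1) //= (bigD1 e2) 1?eq_sym //= big1 => [|j /andP[j1 j2]].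
  have k1 : kap e1 = 1 \/ kap e1 = -1 by lia.
  have k2 : kap e2 = 1 \/ kap e2 = -1 by lia.
  by case: k1 => ->; case: k2 => ->; lia.
by have /eqP := z j j1 j2; rewrite absz_eq0 => /eqP->; rewrite mulr0.
Qed.
End OddCase.
End Component.

(** * Contraction and conclusion *)

Section ComponentCase.
Variable G : multigraph.
Variable t : half_edge G -> int.
Hypothesis t_pm1 : forall h, is_pm1 (t h).
Variable r : vertex G.
Implicit Type v : vertex G.
Local Notation inK e := (component r (endpoint e false)).

Definition solved := exists f, (forall v, excess t f v = 0) /\
  forall e, inK e -> f e <> 0 /\ `|f e| < 8.

Definition obstructed :=
  (exists e, forall f, (forall v, excess t f v = 0) -> f e = 0) \/
  (exists e1 e2, [/\ e1 != e2, endpoint e1 false != endpoint e1 true &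
    forall f, (forall v, excess t f v = 0) -> `|f e1| = `|f e2| ]).

Lemma solved_even (C1 C2 : edge G -> bool) :
  (forall v, even_at C1 v) -> (forall v, even_at C2 v) ->
  (forall e, C1 e -> inK e) -> (forall e, C2 e -> inK e) ->
  (forall e, inK e -> C1 e || C2 e) -> ~~ parity t C1 -> solved \/ obstructed.
Proof.
move=> ev1 ev2 K1 K2 cov p1.
case p2: (parity t C2); last by left; apply: (even_even t_pm1 ev1 ev2); rewrite ?p2.
case: (boolP [exists v, connect (free_step t C1) (v, true) (v, false)]) =>
  [/existsP[v]|/existsPn nC].
  (* The edges used an odd number of times by this negative closed walk form an even set [C] inside
     [C1]. Adding [C] to [C2] makes its parity even and uncovers nothing. *)
  case/free_walk=> W [/= w1 w2 w3].
  have nW : walk_neg t W by case: (walk_neg t W) w3.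
  pose C e := odd (mult W e).
  have CC1 e : C e -> C1 e.
    rewrite /C => oc; have : (0 < mult W e)%N by case: (mult W e) oc.
    by rewrite -has_count => /hasP[h hW /eqP <-]; apply: (allP w2).
  left; apply: (@even_even _ _ t_pm1 r C1 (fun e => C2 e (+) C e)) => //.
  - by move=> x; rewrite /even_at big_split /= (walk_parity x w1) addbb addbF; apply: ev2.
  - by move=> e; case: (boolP (C e)) => [/CC1/K1//|_]; rewrite addbF; apply: K2.
  - move=> e /cov; case: (boolP (C e)) => [/CC1->//|_]; by rewrite addbF.
  - by rewrite parity_xor p2 /parity -walk_neg_mult nW.
have bal : balanced t C1.
  move=> v W w1 w2; apply/negbTE/negP => nW; move/negP: (nC v); apply.
  by rewrite -node_eq (walk_node t true w1 w2) nW.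
have [g [bg hg]] := even_flow t_pm1 ev2 K2.
have bdg v : excess t g v = 2 * (r == v)%:R by rewrite bg p2.
have gC1 e : C1 e -> `|g e| <= 2.
  by move/K1/hg; case: (C2 e) => // ->.
have gM e : inK e -> ~~ C1 e -> `|g e| = 1.
  by move=> eK /negbTE e1; have := hg e eK; have := cov e eK; rewrite e1 /= => ->.
case: (boolP (reached t r C1 g r false)) => hr.
  by left; apply: (reached_flow t_pm1 ev1 bal bdg gC1 gM).
by right; apply: (unreached_cut t_pm1 bdg gM hr).
Qed.

Lemma even_at_component (C : edge G -> bool) (v : vertex G) : even_at C v ->
  even_at (fun e => C e && inK e) v.
Proof.
move=> Cv; case: (boolP (component r v)) => rv.
  rewrite /even_at (eq_bigr (fun h => C h.1)) // => -[e b] /eqP/= hv.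
  by rewrite -(component_edge _ _ b) hv rv andbT.
rewrite /even_at big1 // => -[e b] /eqP/= hv.
by rewrite -(component_edge _ _ b) hv (negbTE rv) andbF.
Qed.

Lemma component_case (C1 C2 : edge G -> bool) :
  (forall v, even_at C1 v) -> (forall v, even_at C2 v) ->
  (forall e, C1 e || C2 e) -> solved \/ obstructed.
Proof.
move=> ev1 ev2 cov.
have ev1' v := even_at_component (ev1 v); have ev2' v := even_at_component (ev2 v).
set D1 := fun e => C1 e && inK e in ev1'; set D2 := fun e => C2 e && inK e in ev2'.
have K1 e : D1 e -> inK e by case/andP.
have K2 e : D2 e -> inK e by case/andP.
have cov' e : inK e -> D1 e || D2 e by rewrite /D1 /D2 => ->; rewrite !andbT.
case p1: (parity t D1); last by apply: (solved_even ev1' ev2'); rewrite ?p1.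
case p2: (parity t D2); last first.
  by apply: (solved_even ev2' ev1'); rewrite ?p2 // => e /cov'; rewrite orbC.
(* Both parities are odd, so the sum of [D1] and [D2] has even parity; with [D1] it still covers. *)
apply: (@solved_even (fun e => D1 e (+) D2 e) D1) => //.
- move=> v; move: (ev1' v) (ev2' v); rewrite /even_at big_split /=.
  by do 2 case: (\big[_/_]_(_ | _) _).
- by move=> e; case: (boolP (D1 e)) => [/K1|_ /K2].
- by move=> e /cov'; case: (D1 e); case: (D2 e).
- by rewrite parity_xor p1 p2.
Qed.
End ComponentCase.

Section Contract.
Variable G : multigraph.
Variable t : half_edge G -> int.
Hypothesis t_pm1 : forall h, is_pm1 (t h).
Variable e1 : edge G.
Let u := endpoint e1 false.
Let v := endpoint e1 true.
Hypothesis uv : u != v.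

(* The contracted edge is kept, as a loop, so that the edge type does not change. *)
Definition contract := @Multigraph (vertex G) (edge G)
  (fun e b => if endpoint e b == u then v else endpoint e b).

(* Switching at [u] first makes the contracted edge positive. *)
Definition contract_sign : half_edge contract -> int :=
  fun h => if @endpoint G h.1 h.2 == u
           then - (t (e1, false) * t (e1, true)) * t h else t h.

Lemma contract_sign_pm1 h : is_pm1 (contract_sign h).
Proof.
rewrite /contract_sign; case: ifP => _ //.
case: (t_pm1 h) => ->; case: (t_pm1 (e1, false)) => ->; case: (t_pm1 (e1, true)) => ->;
  by [left|right].
Qed.

Lemma big_contract (R : Type) (idx : R) (op : Monoid.com_law idx)
    (F : half_edge G -> R) w :
  \big[op/idx]_(h : half_edge contract | incident h w) F h =
  if w == u then idx else
  if w == v then op (\big[op/idx]_(h : half_edge G | incident h u) F h)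
                    (\big[op/idx]_(h : half_edge G | incident h v) F h)
  else \big[op/idx]_(h : half_edge G | incident h w) F h.
Proof.
case: eqP => [->|/eqP wu].
  rewrite big_pred0 // => h; rewrite /incident /=.
  by case: ifP => // _; rewrite eq_sym; apply: negbTE.
case: eqP => [->|/eqP wv].
  rewrite (bigID (fun h => @endpoint G h.1 h.2 == u)) /=; congr (op _ _).
    apply: eq_bigl => h; rewrite /incident /=.
    by case: (@endpoint G h.1 h.2 == u); rewrite ?eqxx ?andbF.
  apply: eq_bigl => h; rewrite /incident /=; move: (@endpoint G _ _) => x.
  by case: (eqVneq x u) => [->|_]; rewrite ?andbT // andbF (negbTE uv).
apply: eq_bigl => h; rewrite /incident /=; move: (@endpoint G _ _) => x.
by case: (eqVneq x u) => // ->; rewrite ![_ == w]eq_sym (negbTE wv) (negbTE wu).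
Qed.

Lemma excess_contract f w : excess contract_sign f w =
  if w == u then 0 else
  if w == v then - (t (e1, false) * t (e1, true)) * excess t f u + excess t f v
  else excess t f w.
Proof.
rewrite /excess (big_contract _ (fun h => contract_sign h * f (@edge_of G h))).
case: eqP => // /eqP wu.
have keep x : x != u ->
    \sum_(h : half_edge G | incident h x) contract_sign h * f (edge_of h) = excess t f x.
  move=> xu; apply: eq_bigr => h /eqP hx; rewrite /contract_sign hx.
  by rewrite (negbTE xu).
case: eqP => _; last by rewrite keep.
rewrite (keep v) 1?eq_sym //; congr (_ + _); rewrite big_distrr /=.
by apply: eq_bigr => h /eqP hx; rewrite /contract_sign hx eqxx mulrA.
Qed.

Lemma even_at_contract (D : edge G -> bool) w :
  (forall x : vertex G, even_at D x) -> even_at (G := contract) D w.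
Proof.
move=> De; rewrite /even_at (big_contract _ (fun h => D h.1)).
case: eqP => // _; case: eqP => _; last exact: De.
by rewrite (negbTE (De u)) (negbTE (De v)).
Qed.

(** A multiple of the step along [e1] removes the excess at [u]; conservation at the merged vertex
    then gives it at [v]. *)
Lemma uncontract f : (forall w, excess contract_sign f w = 0) ->
  exists f', (forall w, excess t f' w = 0) /\ forall e, e != e1 -> f' e = f e.
Proof.
move=> bf.
exists (fun e => f e + - excess t f u * step t (e1, false) e); split; last first.
  by move=> e; rewrite /step eq_sym => /negbTE /= ->; rewrite mulr0 addr0.
move=> w; rewrite excessD excessZ (excess_step t_pm1) /tgt /src /=.
have := bf w; rewrite excess_contract -/u -/v.
have -> : (-1) ^+ neg t e1 = - (t (e1, false) * t (e1, true)) :> int.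
  rewrite /neg; by case: (t_pm1 (e1, false)) => ->; case: (t_pm1 (e1, true)) => ->.
case: (eqVneq w u) => [-> _|wu].
  by rewrite [v == u]eq_sym (negbTE uv) /=; ring.
case: (eqVneq w v) => [->|wv] hb; first by rewrite /= -hb; ring.
by rewrite hb /=; ring.
Qed.

Lemma card_contract :
  (#|[pred e | endpoint (m := contract) e false != endpoint (m := contract) e true]|
   < #|[pred e | endpoint (m := G) e false != endpoint (m := G) e true]|)%N.
Proof.
apply/proper_card/properP; split.
  by apply/subsetP => e; rewrite !inE /=; apply: contra => /eqP->.
exists e1; rewrite !inE //= -/u -/v eqxx.
by rewrite [v == u]eq_sym (negbTE uv) eqxx.
Qed.
End Contract.

Lemma fin_forall_or (T : finType) (A : T -> Prop) (Q : Prop) :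
  (forall x, A x \/ Q) -> (forall x, A x) \/ Q.
Proof.
move=> AQ; have /fin_all_exists[b hb] : forall x, exists b : bool, if b then A x else Q.
  by move=> x; case: (AQ x) => h; [exists true|exists false].
case: (boolP [forall x, b x]) => [/forallP bT|/forallPn[x /negbTE bx]].
  by left=> x; have := hb x; rewrite bT.
by right; have := hb x; rewrite bx.
Qed.

(** Both ends of an edge have the same root, so only one of the chosen flows is seen around each
    vertex. *)
Lemma solved_all (G : multigraph) (t : half_edge G -> int) :
  (forall r, solved t r) ->
  exists f, (forall v, excess t f v = 0) /\ forall e, f e <> 0 /\ `|f e| < 8.
Proof.
move=> /fin_all_exists[F hF].
pose rt := fingraph.root (adj (fun=> 1%N) : rel (vertex G)).
have sym : connect_sym (adj (fun=> 1%N) : rel (vertex G)) by exact: adj_sym.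
exists (fun e => F (rt (endpoint e false)) e); split=> [v|e].
  have [bF _] := hF (rt v); rewrite -[RHS](bF v).
  apply: eq_bigr => -[e b] /eqP/= hv; congr (_ * F _ _); apply/eqP.
  rewrite /rt (root_connect sym) -hv.
  by have := component_edge (endpoint e false) e b; rewrite /component connect0.
have [_] := hF (rt (endpoint e false)); apply.
by rewrite /component sym connect_root.
Qed.

(** Induction on the number of non-loop edges, which contraction lowers while keeping the given flow
    and the even cover. *)
Lemma nowhere_zero_8_bidirected (n : nat) (G : multigraph) (t : half_edge G -> int)
    (fs : edge G -> int) (C1 C2 : edge G -> bool) :
  (#|[pred e | endpoint (m := G) e false != endpoint (m := G) e true]| <= n)%N ->
  (forall h, is_pm1 (t h)) -> (forall v, excess t fs v = 0) -> (forall e, fs e <> 0) ->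
  (forall v, even_at C1 v) -> (forall v, even_at C2 v) -> (forall e, C1 e || C2 e) ->
  exists f, (forall v, excess t f v = 0) /\ forall e, f e <> 0 /\ `|f e| < 8.
Proof.
elim: n G t fs C1 C2 => [|n IH] G t fs C1 C2 hn tpm bfs nz ev1 ev2 cov;
  case: (fin_forall_or (fun r => component_case tpm r ev1 ev2 cov)) => [/solved_all//|];
  case=> [[e /(_ _ bfs)/nz//]|[e1 [e2 [e12 uv eqf]]]].
  by have := card_contract uv; rewrite ltnNge (leq_trans hn).
have [|||||||f [bf hf]] := IH (contract e1) (@contract_sign G t e1) fs C1 C2.
- by rewrite -ltnS; apply: leq_trans (card_contract uv) hn.
- exact: contract_sign_pm1.
- by move=> w; rewrite excess_contract // !bfs mulr0 addr0 !if_same.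
- exact: nz.
- by move=> w; apply: even_at_contract.
- by move=> w; apply: even_at_contract.
- exact: cov.
have [f' [bf' hf']] := uncontract tpm uv bf.
have f'2 : f' e2 = f e2 by apply: hf'; rewrite eq_sym.
exists f'; split=> // e; case: (eqVneq e e1) => [->|/hf'->//].
(* The lifted value on [e1] has the absolute value of that on [e2], which the lift leaves
   unchanged. *)
by have := hf e2; have := eqf f' bf'; rewrite f'2; lia.
Qed.

Lemma odd_absz_excess (G : multigraph) (t : half_edge G -> int) (f : edge G -> int) v :
  (forall h, is_pm1 (t h)) ->
  odd `|excess t f v|%N = \big[addb/false]_(h : half_edge G | incident h v) odd `|f h.1|%N.
Proof.
move=> tpm; rewrite /excess.
rewrite (big_morph (fun x : int => odd `|x|%N) (id1 := false) (op1 := addb)) //.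
  by apply: eq_bigr => h _; rewrite abszM; case: (tpm h) => ->; rewrite mul1n.
by move=> x y; lia.
Qed.

(** The odd values of [f] form [C1]. Adding a flow with values [1, -1] on [C1] and halving gives a
    flow [k], whose odd values form the second set. *)
Lemma even_cover_of_4flow (G : multigraph) : has_nowhere_zero_flow (all_positive G) 4 ->
  exists C1 C2 : edge G -> bool, [/\ forall v : vertex G, even_at C1 v,
    forall v : vertex G, even_at C2 v & forall e, C1 e || C2 e].
Proof.
case=> t [f [[[tpm tpos] bf f4] nz]].
have neg0 e : neg t e = false.
  rewrite /neg; move: (tpos e); rewrite /all_positive.
  by case: (tpm (e, false)) => ->; case: (tpm (e, true)) => ->.
pose C1 e := odd `|f e|%N.
have even_of g v : excess t g v = 0 -> even_at (fun e => odd `|g e|%N) v.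
  by move=> g0; rewrite /even_at -(odd_absz_excess _ _ tpm) g0.
have bal : balanced t C1.
  by move=> v W _ _; rewrite walk_neg_mult big1 // => e _; rewrite neg0 andbF.
have [b [bb hb]] := balanced_flow tpm (fun v => even_of f v (bf v)) bal.
have /fin_all_exists[k hk] : forall e, exists k : int, f e + b e = 2 * k.
  move=> e; exists ((f e + b e) %/ 2)%Z; have := hb e; rewrite /C1; lia.
exists C1, (fun e => odd `|k e|%N); split=> [v|v|e].
- exact/even_of/bf.
- apply: even_of; apply: (@mulfI _ 2) => //.
  rewrite -excessZ -(eq_excess t v hk) excessD bb mulr0 addr0; exact: bf.
(* Off [C1], [|f e| = 2] and [b e = 0], so [|k e| = 1]. *)
- have := nz e; have := f4 e; have := hb e; have := hk e; rewrite /C1; lia.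
Qed.

Theorem theorem1p2 (G : multigraph) (sigma : edge G -> int)
    (hsigma : is_signature sigma)
    (hadm : flow_admissible sigma)
    (h4 : has_nowhere_zero_flow (all_positive G) 4) :
  has_nowhere_zero_flow sigma 8.
Proof.
have [C1 [C2 [ev1 ev2 cov]]] := even_cover_of_4flow h4.
have [k [_ [tau [fs [[otau bfs _] nz]]]]] := hadm.
have [f [bf hf]] := nowhere_zero_8_bidirected (leqnn _) otau.1 bfs nz ev1 ev2 cov.
exists tau, f; split; last by move=> e; case: (hf e).
by split=> // e; case: (hf e).
Qed.
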